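(* Let $\kappa>0$, $r_i,r_{i+1}\in\mathbb{R}^3$, and $\Delta t_{i+1,i}\in(0,\pi/\kappa)$. The two-impulse Clohessy–Wiltshire trajectory $r(\cdot)$ of the chaser spacecraft that has position $r_i$ at time $t_i$ and position $r_{i+1}$ at time $t_{i+1}=t_i+\Delta t_{i+1,i}$ is bounded by the sphere centered at the origin of radius $\delta_{i+1,i}$; that is, for all $t\in(t_i,t_{i+1})$, $\|r(t)\|_2\le\delta_{i+1,i}$, where $$\delta_{i+1,i}=\sigma(\Delta t_{i+1,i})\sqrt{\|r_i\|_2^2+\|r_{i+1}\|_2^2},$$ $$\sigma(t)=\begin{cases}1,& t\in(0,\,0.5\pi/\kappa],\\ 0.5\sqrt2\,\sec(0.5\,\kappa t),& t\in[0.5\pi/\kappa,\,\pi/\kappa).\end{cases}$$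
   Context: Setting: a chaser spacecraft moves relative to a target spacecraft at the origin; the target is on a circular orbit with mean motion $\kappa>0$, and the relative motion is governed by the Clohessy–Wiltshire equations. With position $r_i$ and post-impulse velocity $v_i^+$ at time $t_i$, the position at time $t_i+s$ is $F_{rr}(s)r_i+F_{rv}(s)v_i^+$, where, with $\theta=\kappa s$, $$F_{rr}(s)=\begin{pmatrix}4-3\cos\theta&0&0\\6(\sin\theta-\theta)&1&0\\0&0&\cos\theta\end{pmatrix},\quad F_{rv}(s)=\frac1\kappa\begin{pmatrix}\sin\theta&2(1-\cos\theta)&0\\-2(1-\cos\theta)&4\sin\theta-3\theta&0\\0&0&\sin\theta\end{pmatrix}.$$ $F_{rv}(\tau)$ is invertible for $\tau\in(0,\pi/\kappa)$; transfer times are always assumed to lie in $(0,\pi/\kappa)$. Define $$F_2(s,\tau)=F_{rv}(s)F_{rv}(\tau)^{-1},\qquad F_1(s,\tau)=F_{rr}(s)-F_2(s,\tau)F_{rr}(\tau).$$ The two-impulse trajectory from $r_i$ at $t_i$ to $r_{i+1}$ at $t_{i+1}=t_i+\tau$ is $$r(t_i+s)=F_1(s,\tau)r_i+F_2(s,\tau)r_{i+1},\quad 0\le s\le\tau .$$ *)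

(* Defs.v *)
From mathcomp Require Import all_boot all_order all_algebra.
From mathcomp Require Import all_classical all_reals all_analysis.

Set Implicit Arguments.
Unset Strict Implicit.
Unset Printing Implicit Defensive.

Import Order.TTheory GRing.Theory Num.Theory.
Local Open Scope ring_scope.

(* The library norm on matrices is the sup norm, hence this definition. *)
Definition norm2 (R : realType) (n : nat) (x : 'cV[R]_n) : R :=
  Num.sqrt (\sum_(i < n) x i 0 ^+ 2).

Definition sec (R : realType) (x : R) : R := (cos x)^-1.

Definition mx3_of_rows (R : realType) (rows : seq (seq R)) : 'M[R]_3 :=
  \matrix_(i, j) nth 0 (nth [::] rows i) j.

(* Position blocks of the Clohessy-Wiltshire state-transition matrix, for a
   target at the origin on a circular orbit of mean motion kappa. *)
Definition Frr (R : realType) (kappa s : R) : 'M[R]_3 :=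
  let theta := kappa * s in
  mx3_of_rows
    [:: [:: 4 - 3 * cos theta;         0; 0        ];
        [:: 6 * (sin theta - theta);   1; 0        ];
        [:: 0;                         0; cos theta]].

Definition Frv (R : realType) (kappa s : R) : 'M[R]_3 :=
  let theta := kappa * s in
  kappa^-1 *: mx3_of_rows
    [:: [:: sin theta;               2 * (1 - cos theta);       0        ];
        [:: - (2 * (1 - cos theta)); 4 * sin theta - 3 * theta; 0        ];
        [:: 0;                       0;                         sin theta]].

(* [Frv kappa tau] is invertible for 0 < tau < pi / kappa; outside that range
   [invmx] may be a junk value. *)
Definition F2 (R : realType) (kappa s tau : R) : 'M[R]_3 :=
  Frv kappa s *m invmx (Frv kappa tau).

Definition F1 (R : realType) (kappa s tau : R) : 'M[R]_3 :=
  Frr kappa s - F2 kappa s tau *m Frr kappa tau.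

(* Position at time t on the two-impulse transfer leaving r0 at time t0 and
   reaching r1 at time t0 + tau; meaningful for t0 <= t <= t0 + tau. *)
Definition two_impulse_traj (R : realType) (kappa t0 tau : R)
    (r0 r1 : 'cV[R]_3) (t : R) : 'cV[R]_3 :=
  F1 kappa (t - t0) tau *m r0 + F2 kappa (t - t0) tau *m r1.

(* Used for 0 < t < pi / kappa; both branches equal 1 at t = pi / (2 kappa). *)
Definition sigma (R : realType) (kappa t : R) : R :=
  if t <= 2^-1 * pi / kappa then 1
  else 2^-1 * Num.sqrt 2 * sec (2^-1 * kappa * t).

Definition delta (R : realType) (kappa tau : R) (r0 r1 : 'cV[R]_3) : R :=
  sigma kappa tau * Num.sqrt (norm2 r0 ^+ 2 + norm2 r1 ^+ 2).

(* Main.v *)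
(* In an inertial frame the relative motion obeys R'' = -R + 3 (R.e) e, with e
   the rotating radial unit vector, so rho = |R| satisfies rho'' + rho >= 0
   where it is smooth. Since the transfer lasts less than half a period, Sturm
   comparison gives, with T = kappa * dt and th = kappa * (t - ti),
     rho(th) <= (rho(0) sin(T - th) + rho(T) sin th) / sin T.
   Cauchy-Schwarz then reduces the claim to
     sin^2(T - th) + sin^2 th <= sigma^2 sin^2 T. *)
Require Import Defs.
From mathcomp Require Import all_boot all_order all_algebra.
From mathcomp Require Import all_classical all_reals all_analysis.
From mathcomp Require Import ring lra.
Import Order.TTheory GRing.Theory Num.Theory.
Import numFieldNormedType.Exports.
Local Open Scope ring_scope.

(** * Sturm comparison for the squared distance *)

Lemma derive_ge0_le (R : realType) (f df : R -> R) (a b : R) : a <= b ->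
  (forall x, a <= x <= b -> is_derive x 1 f (df x)) ->
  (forall x, a <= x <= b -> 0 <= df x) -> f a <= f b.
Proof.
move=> ab fdf df0.
have [x| |c] := @MVT_segment R f df a b ab.
- by rewrite in_itv /= => /andP[/ltW ax /ltW xb]; apply: fdf; rewrite ax.
- apply: derivable_within_continuous => x; rewrite in_itv /= => xab.
  by have [] := fdf x xab.
rewrite in_itv /= => cab fE; rewrite -subr_ge0 fE.
by rewrite mulr_ge0 ?subr_ge0// df0.
Qed.

(* Applied with [q] the square of the norm, which stays smooth where the norm
   vanishes. The sign hypothesis says that [W], which is [phi ^+ 2] times the
   derivative of [g = q / phi ^+ 2], is nondecreasing; hence [g] decreases
   before [s] or increases after it. *)
Lemma sturm_square_le (R : realType) (q q1 q2 phi phi1 : R -> R) (a b s M : R) :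
  a <= s <= b ->
  (forall x : R, is_derive x 1 q (q1 x)) ->
  (forall x : R, is_derive x 1 q1 (q2 x)) ->
  (forall x : R, is_derive x 1 phi (phi1 x)) ->
  (forall x : R, is_derive x 1 phi1 (- phi x)) ->
  (forall x, a <= x <= b -> 0 < phi x) ->
  (forall x, 0 <= (q2 x + 2 * q x) * phi x ^+ 2
                  - 2 * q1 x * phi x * phi1 x + 2 * q x * phi1 x ^+ 2) ->
  q a <= M * phi a ^+ 2 -> q b <= M * phi b ^+ 2 -> q s <= M * phi s ^+ 2.
Proof.
move=> /andP[as_ sb] dq dq1 dphi dphi1 phi0 K0 qa qb.
pose W x := q1 x - 2 * q x * phi1 x * (phi x)^-1.
pose g x := q x * (phi x)^-1 ^+ 2.
have dinv x : a <= x <= b ->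
    is_derive x 1 (fun y => (phi y)^-1) (- (phi x)^-2 * phi1 x).
  move=> xab; have := @is_deriveV R phi x (phi1 x) 1 _ (dphi x).
  by rewrite gt_eqF ?phi0// => /(_ isT).
have dg x : a <= x <= b -> is_derive x 1 g (W x * (phi x)^-1 ^+ 2).
  move=> xab; have := dinv x xab => dx; have px := phi0 x xab.
  rewrite /g; apply: is_derive_eq; rewrite /W /GRing.scale /=.
  by field; rewrite gt_eqF.
(* As the derivative of [phi1] is [- phi], it enters the derivative of [W] as the term [2 * q]. *)
pose W1 x := ((q2 x + 2 * q x) * phi x ^+ 2
  - 2 * q1 x * phi x * phi1 x + 2 * q x * phi1 x ^+ 2) / phi x ^+ 2.
have dW x : a <= x <= b -> is_derive x 1 W (W1 x).
  move=> xab; have := dinv x xab => dx; have px := phi0 x xab.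
  rewrite /W; apply: is_derive_eq; rewrite /W1 /GRing.scale /=.
  by field; rewrite gt_eqF.
have gM x : a <= x <= b -> (q x <= M * phi x ^+ 2) = (g x <= M).
  by move=> xab; rewrite /g exprVn ler_pdivrMr// exprn_gt0// phi0.
have Wle x y : a <= x -> x <= y -> y <= b -> W x <= W y.
  move=> ax xy yb; apply: (@derive_ge0_le _ W W1 _ _ xy) => z /andP[xz zy].
    by apply: dW; rewrite (le_trans ax) ?(le_trans zy).
  by rewrite divr_ge0// sqr_ge0.
have ab : a <= b by exact: le_trans sb.
move: qa qb; rewrite !gM ?lexx ?ab ?as_// => ga gb.
have [W0|/ltW W0] := leP (W s) 0.
- rewrite (le_trans _ ga)// -lerN2.
  apply: (@derive_ge0_le _ (fun x => - g x)
    (fun x => - (W x * (phi x)^-1 ^+ 2)) _ _ as_) => // x /andP[ax xs].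
    have xab : a <= x <= b by rewrite ax (le_trans xs).
    by have := dg x xab => dx; apply: is_derive_eq.
  by rewrite oppr_ge0 mulr_le0_ge0 ?sqr_ge0// (le_trans (Wle _ _ ax xs sb)).
- rewrite (le_trans _ gb)//.
  apply: (@derive_ge0_le _ g (fun x => W x * (phi x)^-1 ^+ 2) _ _ sb)
    => x /andP[sx xb].
    by apply: dg; rewrite xb (le_trans as_).
  by rewrite mulr_ge0 ?sqr_ge0// (le_trans W0)// Wle.
Qed.

(* In the rotating frame, [(dx - y, dy + x, dz)] are the components of the
   inertial velocity. *)
Lemma inertial_norm_subsolution (R : realFieldType)
    (x y z dx dy dz p dp : R) :
  0 <= ((2 * (dx ^+ 2 + dy ^+ 2 + dz ^+ 2
             + x * (3 * x + 2 * dy) - y * (2 * dx) - z ^+ 2)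
         + 2 * (x ^+ 2 + y ^+ 2 + z ^+ 2)) * p ^+ 2
       - 2 * (2 * (x * dx + y * dy + z * dz)) * p * dp
       + 2 * (x ^+ 2 + y ^+ 2 + z ^+ 2) * dp ^+ 2).
Proof.
(* The first three squares form the squared length of [p R' - p' R] in the inertial frame; the last
   one comes from the tidal term [3 (R.e) e]. *)
rewrite (_ : _ + _ = 2 * ((p * (dx - y) - dp * x) ^+ 2
  + (p * (dy + x) - dp * y) ^+ 2 + (p * dz - dp * z) ^+ 2)
  + 6 * (p * x) ^+ 2); last by ring.
by rewrite addr_ge0 // mulr_ge0 // ?addr_ge0 // sqr_ge0.
Qed.

(** On [[0, T]] both sines are nonnegative and never vanish together. This gives the positivity that
    [sturm_square_le] asks of its comparison function. *)
Lemma sturm_comparison_gt0 (R : realType) (c0 c1 T t : R) :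
  0 < c0 -> 0 < c1 -> T < pi -> 0 <= t <= T -> 0 < T ->
  0 < c0 * sin (T - t) + c1 * sin t.
Proof.
move=> c00 c10 Tpi /andP[t0 tT] T0.
move: tT; rewrite le_eqVlt => /predU1P[->|tT].
  by rewrite subrr sin0 mulr0 add0r mulr_gt0 // sin_gt0_pi // T0.
apply: ltr_wpDr.
  by rewrite mulr_ge0 ?(ltW c10)// sin_ge0_pi// t0 ltW// (lt_trans tT).
by rewrite mulr_gt0 // sin_gt0_pi // subr_gt0 tT /= (le_lt_trans _ Tpi)// gerBl.
Qed.

(** The derivative hypotheses are the Clohessy-Wiltshire equations in the angle variable, that is,
    with mean motion 1. *)
Lemma cw_coast_norm_le (R : realType) (x y z dx dy dz : R -> R) (T s : R) :
  0 < T < pi -> 0 <= s <= T ->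
  (forall t : R, is_derive t 1 x (dx t)) ->
  (forall t : R, is_derive t 1 y (dy t)) ->
  (forall t : R, is_derive t 1 z (dz t)) ->
  (forall t : R, is_derive t 1 dx (3 * x t + 2 * dy t)) ->
  (forall t : R, is_derive t 1 dy (- (2 * dx t))) ->
  (forall t : R, is_derive t 1 dz (- z t)) ->
  let q t := x t ^+ 2 + y t ^+ 2 + z t ^+ 2 in
  (q s * sin T ^+ 2 <= (q 0 + q T) * (sin (T - s) ^+ 2 + sin s ^+ 2) : Prop).
Proof.
move=> /andP[T0 Tpi] sT Dx Dy Dz Ddx Ddy Ddz q.
have q_ge0 t : 0 <= q t by rewrite !addr_ge0 ?sqr_ge0.
have sinT : 0 < sin T by rewrite sin_gt0_pi // T0.
apply/ler_addgt0Pr => e e0.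
(* The [e / 4] keeps the comparison function positive at the end points. *)
pose c0 := Num.sqrt (q 0 + e / 4); pose c1 := Num.sqrt (q T + e / 4).
have e4 : 0 < e / 4 by rewrite divr_gt0.
have c00 : 0 < c0 by rewrite sqrtr_gt0 ltr_wpDl.
have c10 : 0 < c1 by rewrite sqrtr_gt0 ltr_wpDl.
have c0E : c0 ^+ 2 = q 0 + e / 4 by rewrite sqr_sqrtr // ltW // ltr_wpDl.
have c1E : c1 ^+ 2 = q T + e / 4 by rewrite sqr_sqrtr // ltW // ltr_wpDl.
(* The harmonic function with end values [c0 * sin T] and [c1 * sin T]; the factor [sin T] is
   compensated by the choice [M = sin T ^- 2] below. *)
pose phi t := c0 * sin T * cos t + (c1 - c0 * cos T) * sin t.
pose dphi t := (c1 - c0 * cos T) * cos t - c0 * sin T * sin t.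
have phiE t : phi t = c0 * sin (T - t) + c1 * sin t.
  by rewrite /phi sinB; ring.
have Dphi (t : R) : is_derive t 1 phi (dphi t).
  by rewrite /phi; apply: is_derive_eq; rewrite /dphi /GRing.scale /=; ring.
have Ddphi (t : R) : is_derive t 1 dphi (- phi t).
  by rewrite /dphi; apply: is_derive_eq; rewrite /phi /GRing.scale /=; ring.
pose dq t := 2 * (x t * dx t + y t * dy t + z t * dz t).
pose ddq t := 2 * (dx t ^+ 2 + dy t ^+ 2 + dz t ^+ 2
  + x t * (3 * x t + 2 * dy t) - y t * (2 * dx t) - z t ^+ 2).
have Dq (t : R) : is_derive t 1 q (dq t).
  by rewrite /q; apply: is_derive_eq; rewrite /dq /GRing.scale /=; ring.
have Ddq (t : R) : is_derive t 1 dq (ddq t).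
  by rewrite /dq; apply: is_derive_eq; rewrite /ddq /GRing.scale /=; ring.
have := @sturm_square_le R q dq ddq phi dphi 0 T s (sin T ^- 2) sT Dq Ddq Dphi Ddphi.
have -> : sin T ^- 2 * phi 0 ^+ 2 = c0 ^+ 2.
  by rewrite phiE subr0 sin0; field; rewrite gt_eqF.
have -> : sin T ^- 2 * phi T ^+ 2 = c1 ^+ 2.
  by rewrite phiE subrr sin0; field; rewrite gt_eqF.
rewrite c0E c1E !lerDl (ltW e4) mulrC ler_pdivlMr ?exprn_gt0// => le_phi.
have {le_phi} : q s * sin T ^+ 2 <= phi s ^+ 2.
  apply: le_phi => // t; last exact: inertial_norm_subsolution.
  by move=> tT; rewrite phiE sturm_comparison_gt0.
move/le_trans; apply; rewrite phiE.
have A1 : sin (T - s) ^+ 2 <= 1 by rewrite -(cos2Dsin2 (T - s)) lerDr sqr_ge0.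
have B1 : sin s ^+ 2 <= 1 by rewrite -(cos2Dsin2 s) lerDr sqr_ge0.
(* Cauchy-Schwarz as a square. The excess [e / 2] in [c0 ^+ 2 + c1 ^+ 2] costs at most [e], since
   the squared sines sum to at most 2. *)
have : 0 <= (c0 * sin s - c1 * sin (T - s)) ^+ 2 by exact: sqr_ge0.
have : 0 <= e * (2 - sin (T - s) ^+ 2 - sin s ^+ 2).
  by rewrite mulr_ge0 ?(ltW e0)//; lra.
move: (sin (T - s)) (sin s) {A1 B1} => A B.
have -> : q 0 = c0 ^+ 2 - e / 4 by rewrite c0E addrK.
have -> : q T = c1 ^+ 2 - e / 4 by rewrite c1E addrK.
by rewrite !expr2; lra.
Qed.

(** * The trigonometric estimate behind [sigma] *)

(** With [T = kappa * dt], the left side equals [1 - cos T * cos (T - 2 * s)]. If [cos T >= 0] it is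
    largest at the end points, with value [sin T ^+ 2]; otherwise at [s = T / 2], with value
    [1 - cos T]. The right side is this maximum in both cases. *)
Lemma sigma_sin_le (R : realType) (kappa dt s : R) :
  0 < kappa -> 0 < dt < pi / kappa -> 0 <= s <= kappa * dt ->
  sin (kappa * dt - s) ^+ 2 + sin s ^+ 2 <=
    sigma kappa dt ^+ 2 * sin (kappa * dt) ^+ 2.
Proof.
move=> k0 /andP[dt0]; rewrite ltr_pdivlMr // mulrC => Tpi /andP[s0 sT].
have T0 : 0 < kappa * dt by exact: mulr_gt0.
rewrite /sigma ler_pdivlMr // (mulrC dt).
set T := kappa * dt in Tpi sT T0 *.
have cTE : cos T = cos (T - s) * cos s - sin (T - s) * sin s.
  by rewrite -cosD subrK.
have sTE : sin T = sin (T - s) * cos s + cos (T - s) * sin s.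
  by rewrite -sinD subrK.
have := cos2sin2 s; have := cos2sin2 (T - s).
have [h|h] := leP T (2^-1 * pi).
  (* This product is exactly the right side minus the left side, modulo the Pythagorean
     identities. *)
  have : 0 <= 2 * sin (T - s) * sin s * cos T.
    by rewrite !mulr_ge0 // ?sin_ge0_pi ?cos_ge0_pihalf//; lra.
  rewrite {}cTE {}sTE.
  move: (sin (T - s)) (sin s) (cos (T - s)) (cos s) => A B C D H CA DB.
  rewrite -subr_ge0; apply: le_trans H _.
  rewrite le_eqVlt; apply/orP; left; apply/eqP.
  by ring: CA DB.
have cosT : cos T <= 0.
  by rewrite -oppr_ge0 -sinBpihalf sin_ge0_pi//; lra.
have h2 : T = (2^-1 * T) *+ 2 by rewrite -mulr_natr; field.
have ch : 0 < cos (2^-1 * T) by apply: cos_gt0_pihalf; lra.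
(* By the half-angle formulas the secant cancels and [2 * sin (T / 2) ^+ 2] remains. *)
have -> : (2^-1 * Num.sqrt 2 * sec (2^-1 * kappa * dt)) ^+ 2 * sin T ^+ 2 = 1 - cos T.
  rewrite -[2^-1 * kappa * dt]mulrA -/T /sec {2 3}h2 sin_mulr2n cos_mulr2n.
  rewrite [in RHS]cos2sin2 !exprMn sqr_sqrtr //.
  by field; rewrite gt_eqF.
have : 0 <= - cos T * (1 - cos ((T - s) - s)).
  by rewrite mulr_ge0 ?oppr_ge0// subr_ge0 cos_le1.
rewrite cosB {}cTE {sTE cosT}.
move: (sin (T - s)) (sin s) (cos (T - s)) (cos s) => A B C D H CA DB.
rewrite -subr_ge0; apply: le_trans H _.
rewrite le_eqVlt; apply/orP; left; apply/eqP.
by ring: CA DB.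
Qed.

Lemma sigma_ge0 (R : realType) (kappa dt : R) :
  0 < kappa -> 0 < dt < pi / kappa -> 0 <= sigma kappa dt.
Proof.
move=> k0 /andP[dt0]; rewrite ltr_pdivlMr // mulrC => Tpi.
have T0 : 0 < kappa * dt by exact: mulr_gt0.
rewrite /sigma; case: ifP => // _.
rewrite mulr_ge0 ?mulr_ge0 ?sqrtr_ge0 // /sec invr_ge0 -mulrA.
by rewrite cos_ge0_pihalf //; lra.
Qed.

(** * Invertibility of [Frv] *)

(** The expression is the determinant of the in-plane block of [kappa *: Frv]. In the half angle [h]
    it factors, and [sin h - h * cos h] is nonnegative because [x * sin x] is the derivative of
    [sin x - x * cos x]. *)
Lemma Frv_det_gt0 (R : realType) (t : R) : 0 < t < pi ->
  0 < 8 * (1 - cos t) - 3 * t * sin t.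
Proof.
move=> /andP[t0 tpi]; pose h := 2^-1 * t.
have tE : t = h *+ 2 by rewrite /h -mulr_natr; field.
have h0 : 0 < h by rewrite /h; lra.
have sinh : 0 < sin h by rewrite sin_gt0_pi // h0 /h; lra.
have : 0 <= sin h - h * cos h.
  have -> : 0 = sin 0 - 0 * cos 0 :> R by rewrite sin0 mul0r subr0.
  apply: (@derive_ge0_le _ (fun x => sin x - x * cos x) (fun x => x * sin x)).
  - exact: ltW.
  - by move=> x _; apply: is_derive_eq; rewrite /GRing.scale /=; ring.
  - move=> x /andP[x0 xh]; rewrite mulr_ge0 // sin_ge0_pi // x0 /=.
    by apply: le_trans xh _; rewrite /h; lra.
move=> k0.
have -> : 8 * (1 - cos t) - 3 * t * sin t
    = 4 * (sin h * (sin h + 3 * (sin h - h * cos h))).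
  rewrite tE sin_mulr2n cos_mulr2n cos2sin2; ring.
by rewrite mulr_gt0 // mulr_gt0 // ltr_wpDr // mulr_ge0.
Qed.

Lemma Frv_unitmx (R : realType) (kappa tau : R) :
  0 < kappa -> 0 < tau < pi / kappa -> Frv kappa tau \in unitmx.
Proof.
move=> k0 /andP[t0]; rewrite ltr_pdivlMr // mulrC => Tpi.
have T0 : 0 < kappa * tau by exact: mulr_gt0.
have sT : sin (kappa * tau) != 0 by rewrite gt_eqF // sin_gt0_pi // T0.
have := @Frv_det_gt0 R (kappa * tau); rewrite T0 Tpi => /(_ isT) /lt0r_neq0.
have := cos2sin2 (kappa * tau).
(* The explicit inverse: the adjugate of the in-plane block over its determinant [D], and the
   reciprocal of the out-of-plane entry. *)
pose B := kappa *: mx3_of_rows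
  (let t := kappa * tau in let D := 8 * (1 - cos t) - 3 * t * sin t in
   [:: [:: (4 * sin t - 3 * t) / D; - (2 * (1 - cos t)) / D; 0];
       [:: 2 * (1 - cos t) / D; sin t / D; 0];
       [:: 0; 0; (sin t)^-1]]).
move=> cs D0.
suff /mulmx1_unit[] : Frv kappa tau *m B = 1%:M by [].
rewrite /Frv /B -scalemxAl -scalemxAr scalerA mulVf ?gt_eqF // scale1r.
move: (kappa * tau) {B T0 Tpi} sT cs D0 => t.
move: (sin t) (cos t) => S C S0 cs D0.
apply/matrixP => -[[|[|[|i]]] Hi] // -[[|[|[|j]]] Hj] //;
  rewrite !mxE !big_ord_recl big_ord0 !mxE /=;
  rewrite ?mulr0 ?mul0r ?addr0 ?add0r //; field: cs => //.
Qed.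

(** * From coasting arcs to the two-impulse trajectory *)

(** Exhibits the transfer as a coast from [r0] whose initial velocity is the one that aims at
    [r1]. *)
Lemma two_impulse_trajE (R : realType) (kappa t0 tau : R) (r0 r1 : 'cV[R]_3) t :
  two_impulse_traj kappa t0 tau r0 r1 t =
  Frr kappa (t - t0) *m r0
  + Frv kappa (t - t0) *m (invmx (Frv kappa tau) *m (r1 - Frr kappa tau *m r0)).
Proof.
rewrite /two_impulse_traj /F1 /F2 mulmxBl mulmxBr mulmxBr !mulmxA.
by rewrite addrA addrAC.
Qed.

Lemma cw_norm2_le (R : realType) (kappa tau s : R) (r v : 'cV[R]_3) :
  let pos u := Frr kappa u *m r + Frv kappa u *m v in
  0 < kappa -> 0 < kappa * tau < pi -> 0 <= s <= tau ->
  norm2 (pos s) ^+ 2 * sin (kappa * tau) ^+ 2 <=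
  (norm2 (pos 0) ^+ 2 + norm2 (pos tau) ^+ 2)
    * (sin (kappa * tau - kappa * s) ^+ 2 + sin (kappa * s) ^+ 2).
Proof.
move=> pos k0 Tpi /andP[s0 stau].
pose x0 := r 0 0; pose y0 := r 1 0; pose z0 := r 2 0.
(* Initial velocity components per unit of angle [kappa * t] instead of time. *)
pose a := kappa^-1 * v 0 0; pose b := kappa^-1 * v 1 0; pose c := kappa^-1 * v 2 0.
pose X t : R := (4 - 3 * cos t) * x0 + (sin t * a + 2 * (1 - cos t) * b).
pose dX t : R := 3 * sin t * x0 + (cos t * a + 2 * sin t * b).
pose Y t : R := 6 * (sin t - t) * x0 + y0
  + (- (2 * (1 - cos t)) * a + (4 * sin t - 3 * t) * b).
pose dY t : R := 6 * (cos t - 1) * x0 + (- (2 * sin t) * a + (4 * cos t - 3) * b).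
pose Z t : R := cos t * z0 + sin t * c.
pose dZ t : R := - sin t * z0 + cos t * c.
have posE u : norm2 (pos u) ^+ 2
    = X (kappa * u) ^+ 2 + Y (kappa * u) ^+ 2 + Z (kappa * u) ^+ 2.
  rewrite sqr_sqrtr; last by apply: sumr_ge0 => i _; exact: sqr_ge0.
  rewrite !big_ord_recl big_ord0 /pos !mxE !big_ord_recl !big_ord0 !mxE /=.
  have -> : lift ord0 ord0 = 1 :> 'I_3 by exact: val_inj.
  have -> : lift ord0 (lift ord0 ord0) = 2 :> 'I_3 by exact: val_inj.
  rewrite /X /Y /Z /a /b /c /x0 /y0 /z0 ; ring.
rewrite !posE mulr0; apply: (@cw_coast_norm_le R X Y Z dX dY dZ) => //.
- by rewrite mulr_ge0 ?(ltW k0) //= ler_pM2l.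
- by move=> t; rewrite /X; apply: is_derive_eq; rewrite /dX /GRing.scale /=; ring.
- by move=> t; rewrite /Y; apply: is_derive_eq; rewrite /dY /GRing.scale /=; ring.
- by move=> t; rewrite /Z; apply: is_derive_eq; rewrite /dZ /GRing.scale /=; ring.
- by move=> t; rewrite /dX; apply: is_derive_eq; rewrite /X /dY /GRing.scale /=; ring.
- by move=> t; rewrite /dY; apply: is_derive_eq; rewrite /dX /GRing.scale /=; ring.
- by move=> t; rewrite /dZ; apply: is_derive_eq; rewrite /Z /GRing.scale /=; ring.
Qed.

Lemma Frr0 (R : realType) (kappa : R) : Frr kappa 0 = 1%:M.
Proof.
apply/matrixP => -[[|[|[|i]]] Hi] // -[[|[|[|j]]] Hj] //;
  rewrite !mxE /= ?mulr0 ?sin0 ?cos0; ring.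
Qed.

Lemma Frv0 (R : realType) (kappa : R) : Frv kappa 0 = 0.
Proof.
apply/matrixP => -[[|[|[|i]]] Hi] // -[[|[|[|j]]] Hj] //;
  rewrite !mxE /= ?mulr0 ?sin0 ?cos0; ring.
Qed.

Theorem theorem2 (R : realType) (kappa ti dt : R) (ri ri1 : 'cV[R]_3)
    (hkappa : 0 < kappa) (hdt : 0 < dt < pi / kappa) :
  forall t : R, ti < t < ti + dt ->
    norm2 (two_impulse_traj kappa ti dt ri ri1 t) <= delta kappa dt ri ri1.
Proof.
move=> t /andP[tit tdt].
have Tpi : 0 < kappa * dt < pi.
  by move: hdt => /andP[dt0]; rewrite ltr_pdivlMr // mulrC mulr_gt0 // => ->.
have sT : 0 <= t - ti <= dt by lra.
have sigma0 := sigma_ge0 _ _ _ hkappa hdt.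
have N0 : 0 <= norm2 ri ^+ 2 + norm2 ri1 ^+ 2 by rewrite addr_ge0 ?sqr_ge0.
rewrite -ler_sqr ?nnegrE ?sqrtr_ge0 ?mulr_ge0 ?sqrtr_ge0 //.
rewrite /delta exprMn (sqr_sqrtr N0) two_impulse_trajE.
set v := invmx _ *m _.
have := @cw_norm2_le R kappa dt (t - ti) ri v hkappa Tpi sT.
rewrite Frr0 Frv0 mul1mx mul0mx addr0.
have -> : Frr kappa dt *m ri + Frv kappa dt *m v = ri1.
  by rewrite /v mulKVmx ?Frv_unitmx // addrC subrK.
have S0 : 0 < sin (kappa * dt) ^+ 2 by rewrite exprn_gt0 // sin_gt0_pi.
move=> le_sin; rewrite -(ler_pM2r S0); apply: le_trans le_sin _.
rewrite [leRHS]mulrAC [leRHS]mulrC ler_wpM2l // sigma_sin_le //.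
by move: sT => /andP[s0 sT]; rewrite mulr_ge0 ?(ltW hkappa) //= ler_pM2l.
Qed.
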